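(* Let $f\colon\mathbb{R}\to\,]-\infty,+\infty]$ be convex, lower semicontinuous and proper, and suppose that $f$ is even, $f(0)=0$, $f(x)>0$ for all $x\neq 0$, and $f'(0)=0$. Let $A=\mathbb{R}\times\{0\}$ and $B=\operatorname{epi} f=\{(x,r)\in\mathbb{R}^2 : f(x)\leq r\}$. Let $x_0>0$ with $x_0\in\operatorname{dom} f$, let $a_0=(x_0,0)$, and for every $n\in\mathbb{N}$ let $a_{n+1}=P_AP_B(a_n)=(x_{n+1},0)$. Then the following hold: (1) For every $n\in\mathbb{N}$, $x_{n+1}(x_{n+1}-x_n)+f(x_{n+1})^2\leq 0$. (2) For every $n\in\mathbb{N}$, there exists $x_{n+1}^*\in\partial f(x_{n+1})$ such that $x_n=x_{n+1}+f(x_{n+1})x_{n+1}^*$. (3) $x_n\to 0$ sublinearly, i.e., $\dfrac{x_{n+1}}{x_n}\to 1$. (4) If $f$ is differentiable on some interval $[0,\delta]$, where $\delta>0$, and there exists $q\in\mathbb{R}$ such that $$\lim_{x\downarrow 0}\frac{f(x)f'(x)}{x^q}=c_q\in\,]0,+\infty[,$$ then $x_n\to 0$ logarithmically, i.e., $\dfrac{x_{n+1}-x_{n+2}}{x_n-x_{n+1}}\to 1$.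
   Context: $\mathbb{N}=\{0,1,2,\dots\}$. For a nonempty closed convex set $C\subseteq\mathbb{R}^2$, $P_C$ denotes the Euclidean nearest point projection onto $C$; $\operatorname{dom} f=\{x: f(x)<+\infty\}$; $\partial f$ is the convex subdifferential. A sequence $(\alpha_n)$ of positive reals with $\alpha_n\to 0$ converges to $0$ sublinearly if $\alpha_{n+1}/\alpha_n\to 1$, and logarithmically if it converges sublinearly and $|\alpha_{n+1}-\alpha_{n+2}|/|\alpha_n-\alpha_{n+1}|\to 1$. *)

(* Defs.v *)
From HB Require Import structures.
From mathcomp Require Import all_boot all_order all_algebra.
From mathcomp Require Import all_classical all_reals all_analysis.

Set Implicit Arguments.
Unset Strict Implicit.
Unset Printing Implicit Defensive.

Import Order.TTheory GRing.Theory Num.Theory.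
Import numFieldNormedType.Exports.

Local Open Scope classical_set_scope.
Local Open Scope ring_scope.

Definition proper_fun (R : realType) (f : R -> \bar R) : Prop :=
  (forall x, (f x != -oo)%E) /\ (exists x, (f x < +oo)%E).

(* [convex_function] of MathComp-Analysis only covers finite-valued functions.
   The sum below is never of the form (+oo) + (-oo) for a proper [f]. *)
Definition econvex_fun (R : realType) (f : R -> \bar R) : Prop :=
  forall x y t : R, 0 < t -> t < 1 ->
    (f ((1 - t) * x + t * y)%R <= (1 - t)%:E * f x + t%:E * f y)%E.

Definition edom (R : realType) (f : R -> \bar R) : set R :=
  [set x | (f x < +oo)%E].

Definition epi (R : realType) (f : R -> \bar R) : set (R * R) :=
  [set p | (f p.1 <= (p.2)%:E)%E].

Definition subdifferential (R : realType) (f : R -> \bar R) (x : R) : set R :=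
  [set u | forall y : R, (f x + (u * (y - x))%:E <= f y)%E].

(* [fine] sends +oo to 0, so finiteness near [x] has to be required
   separately. *)
Definition is_ederive (R : realType) (f : R -> \bar R) (x l : R) : Prop :=
  (\forall y \near x, f y \is a fin_num) /\
  is_derive x (1 : R) (fine \o f : R -> R) l.

(* The norm of the library on [R * R] is the max norm, hence an explicit
   Euclidean distance. *)
Definition eucl_dist (R : realType) (p q : R * R) : R :=
  Num.sqrt ((p.1 - q.1) ^+ 2 + (p.2 - q.2) ^+ 2).

(* [get] picks the nearest point, which exists and is unique when [C] is
   nonempty, closed and convex; its value is unspecified if there is none. *)
Definition eproj (R : realType) (C : set (R * R)) (p : R * R) : R * R :=
  get [set c | C c /\ forall d, C d -> eucl_dist p c <= eucl_dist p d].

Definition x_axis (R : realType) : set (R * R) := setT `*` [set 0].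
Arguments x_axis R : clear implicits.

Definition sublinearly_to0 (R : realType) (u : R^nat) : Prop :=
  [/\ forall n, 0 < u n,
      u n @[n --> \oo] --> (0 : R)
    & u n.+1 / u n @[n --> \oo] --> (1 : R)].

Definition logarithmically_to0 (R : realType) (u : R^nat) : Prop :=
  sublinearly_to0 u /\
  `|u n.+1 - u n.+2| / `|u n - u n.+1| @[n --> \oo] --> (1 : R).

(* Main.v *)
Require Import Defs.
From HB Require Import structures.
From mathcomp Require Import all_boot all_order all_algebra.
From mathcomp Require Import all_classical all_reals all_analysis.
From mathcomp Require Import ring lra.

Set Implicit Arguments.
Unset Strict Implicit.
Unset Printing Implicit Defensive.

Import Order.TTheory GRing.Theory Num.Theory.
Import numFieldNormedType.Exports.

Local Open Scope classical_set_scope.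
Local Open Scope ring_scope.

(** Write y for the abscissa of the point of epi f nearest to (x, 0).  That
    point lies on the graph of f, and the obtuse-angle characterisation of a
    projection onto a closed convex set becomes
      (x - y) (z - y) <= f(y) (f(z) - f(y))      for every z in dom f,
    which is the relation [epi_step] below.  Everything else is read off from
    this one inequality by choosing z.

    - z = 0 gives y (y - x) + f(y)^2 <= 0; z = x excludes y = 0, so f(y) > 0
      and the former forces 0 < y < x.  Dividing by f(y) shows that
      (x - y) / f(y) is a subgradient of f at y.
    - The sequence decreases to some L >= 0.  As f(L) <= f(x_n) by convexity,
      the choice z = 0 gives f(L)^2 <= 0 in the limit, hence L = 0.
    - z = 2 y gives x / y <= 1 + 2 (f(y) / y) (f(2 y) / (2 y)).  Both quotients
      are difference quotients of f at 0, so they vanish in the limit because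
      f'(0) = 0, and x_n / x_(n+1) tends to 1.
    - Where f is differentiable, z = y minimises f(y) f(z) - (x - y) z, so that
      x - y = f(y) f'(y).  With phi(y) = f(y) f'(y) / y^q, which tends to
      c > 0, the quotient of consecutive gaps is
      phi(x_(n+2)) / phi(x_(n+1)) * (x_(n+2) / x_(n+1))^q, and both factors
      tend to 1, the second one by the sublinear convergence. *)

(** * Nearest points in the Euclidean plane *)

Definition sqdist (R : realType) (p q : R * R) : R :=
  (p.1 - q.1) ^+ 2 + (p.2 - q.2) ^+ 2.

Lemma le_eucl_dist (R : realType) (p q r : R * R) :
  (eucl_dist p q <= eucl_dist p r) = (sqdist p q <= sqdist p r).
Proof. by rewrite /eucl_dist ler_sqrt // addr_ge0 ?sqr_ge0. Qed.

Lemma continuous_sqdist (R : realType) (p : R * R) : continuous (sqdist p).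
Proof.
move=> q; apply: cvgD; apply: cvgM; (apply: cvgB; first exact: cvg_cst);
  (exact: cvg_fst || exact: cvg_snd).
Qed.

(** A point of C at least as close to p as a given c0 lies in a box around p,
    so the distance only has to be minimised over a compact set. *)
Lemma eproj_min (R : realType) (C : set (R * R)) (p : R * R) :
  closed C -> C !=set0 ->
  C (eproj C p) /\ forall d, C d -> sqdist p (eproj C p) <= sqdist p d.
Proof.
move=> cC [c0 Cc0].
suff [c [Cc cmin]] : exists c, C c /\ forall d, C d -> sqdist p c <= sqdist p d.
  have [|Ce emin] := @getPex _
      [set c | C c /\ forall d, C d -> eucl_dist p c <= eucl_dist p d].
    by exists c; split => // d /cmin; rewrite le_eucl_dist.
  by split => // d Cd; rewrite -le_eucl_dist; exact: emin.
(* The 1 makes r >= 1, so that a square at most r forces a root at most r and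
   no square root has to be taken. *)
pose r := 1 + sqdist p c0.
have r1 : 1 <= r by rewrite /r /sqdist lerDl addr_ge0 ?sqr_ge0.
pose K := (`[p.1 - r, p.1 + r] `*` `[p.2 - r, p.2 + r]) `&` C.
have K_near d : C d -> sqdist p d <= sqdist p c0 -> K d.
  move=> Cd dc0; split => //; rewrite /= !in_itv /=.
  have {dc0} : sqdist p d <= r by rewrite /r; lra.
  rewrite /sqdist => dr.
  have := sqr_ge0 (p.1 - d.1); have := sqr_ge0 (p.2 - d.2).
  by split; nra.
have Kc0 : K c0 by exact: K_near.
have [||c] := @compact_EVT_min _ R (sqdist p) K (ex_intro _ _ Kc0).
- apply: compact_closedI => //.
  by apply: compact_setX; exact: segment_compact.
- by apply: continuous_subspaceT; exact: continuous_sqdist.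
rewrite inE => -[_ Cc] cmin; exists c; split => // d Cd.
have [/(K_near _ Cd) Kd|] := leP (sqdist p d) (sqdist p c0).
  by apply: cmin; rewrite inE.
by move/ltW; apply: le_trans; apply: cmin; rewrite inE.
Qed.

Lemma eproj_x_axis (R : realType) (p : R * R) : eproj (x_axis R) p = (p.1, 0).
Proof.
have axis z : x_axis R (z, 0) by [].
suff [[_ e2] /(_ (p.1, 0) (axis _))] : x_axis R (eproj (x_axis R) p) /\
    forall d, x_axis R d -> sqdist p (eproj (x_axis R) p) <= sqdist p d.
  move: (eproj _ p) e2 => [e1 e2'] /= ->; rewrite /sqdist /=.
  rewrite lerD2r subrr expr0n /= => h; congr pair.
  by apply/eqP; rewrite eq_sym -subr_eq0 -sqrf_eq0 eq_le h sqr_ge0.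
apply: eproj_min; last by exists (0, 0).
rewrite (_ : x_axis R = snd @^-1` [set 0]); last first.
  by apply/seteqP; split => [u [_]|u] //.
apply: preimage_closed; last exact: closed_eq.
by move=> u _; exact: cvg_snd.
Qed.

(** Moving from the nearest point e a fraction t towards d changes the squared
    distance by -2 t s + t^2 |d - e|^2, where s is the scalar product in
    question; if s were positive, this would be negative for small t. *)
Lemma eproj_obtuse (R : realType) (C : set (R * R)) (p d : R * R) :
  closed C ->
  (forall u v t, C u -> C v -> 0 < t < 1 ->
    C ((1 - t) * u.1 + t * v.1, (1 - t) * u.2 + t * v.2)) ->
  C d ->
  (p.1 - (eproj C p).1) * (d.1 - (eproj C p).1) +
  (p.2 - (eproj C p).2) * (d.2 - (eproj C p).2) <= 0.
Proof.
move=> cC convC Cd; have [|Ce emin] := eproj_min p cC; first by exists d.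
set e := eproj C p in Ce emin *.
rewrite leNgt; apply/negP; set s := (X in 0 < X) => s0.
have D0 : 0 <= sqdist e d by rewrite addr_ge0 ?sqr_ge0.
(* The denominator exceeds s, so that t < 1, and also |d - e|^2, so that
   t |d - e|^2 < s. *)
pose t := s / (s + sqdist e d + 1).
have den0 : 0 < s + sqdist e d + 1 by lra.
have t0 : 0 < t by exact: divr_gt0.
have tE : t * (s + sqdist e d + 1) = s by rewrite divfK // gt_eqF.
have t1 : t < 1 by rewrite ltr_pdivrMr //; lra.
have := emin _ (convC e d t Ce Cd _); rewrite t0 t1 => /(_ isT).
rewrite -subr_ge0; set A := (X in 0 <= X).
have -> : A = t * (t * sqdist e d - 2 * s) by rewrite /A /s /sqdist /=; ring.
rewrite pmulr_rge0 //; nra.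
Qed.

(** * Projecting onto an epigraph *)

(** If r < f(y), a real b strictly between them separates: f stays above b near
    y and the ordinate stays below b near r. *)
Lemma closed_epi (R : realType) (f : R -> \bar R) :
  lower_semicontinuous f -> closed (epi f).
Proof.
move=> f_lsc; rewrite -openC openE => -[y r] /= /negP; rewrite -ltNge /= => rf.
have [b rb bf] : exists2 b, r < b & (b%:E < f y)%E.
  move: rf; case: (f y) => [s| |] //; last first.
    by exists (r + 1); [rewrite ltrDl|exact: ltry].
  rewrite lte_fin => rs; exists ((r + s) / 2); rewrite ?lte_fin; lra.
have [V Vy Vf] := f_lsc _ _ bf.
exists (V, [set s | s < b]) => /=.
  by split => //=; exact: lt_nbhsl.
move=> -[z s] [/= /Vf bz sb] /=; apply/negP; rewrite -ltNge.
by apply: lt_trans bz; rewrite lte_fin.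
Qed.

Lemma convex_epi (R : realType) (f : R -> \bar R) (u v : R * R) (t : R) :
  econvex_fun f -> epi f u -> epi f v -> 0 < t < 1 ->
  epi f ((1 - t) * u.1 + t * v.1, (1 - t) * u.2 + t * v.2).
Proof.
move=> cf; rewrite /epi /= => fu fv /andP[t0 t1].
apply: (le_trans (cf _ _ _ t0 t1)); rewrite [X in (_ <= X)%E]EFinD !EFinM.
by apply: leeD; apply: lee_wpmul2l => //; rewrite lee_fin ?subr_ge0 ltW.
Qed.

(** The first-order optimality condition for y to minimise
    (x - z)^2 + f(z)^2 over z.  Multiplying the subgradient inequality by f(y)
    keeps the condition meaningful when f(y) = 0. *)
Definition epi_step (R : realType) (f : R -> \bar R) (x y : R) : Prop :=
  f y \is a fin_num /\
  forall z, f z \is a fin_num ->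
    (x - y) * (z - y) <= fine (f y) * (fine (f z) - fine (f y)).

(** The nearest point (y, r) satisfies r = f(y), for otherwise (y, f(y)), with
    0 <= f(y) < r, would be closer to the horizontal axis.  Nonnegativity of f
    is what makes lowering the ordinate an improvement. *)
Lemma eproj_epi_step (R : realType) (f : R -> \bar R) (x : R) :
  econvex_fun f -> lower_semicontinuous f ->
  (forall z, (0 <= f z)%E) -> (exists z, f z \is a fin_num) ->
  epi_step f x (eproj (epi f) (x, 0)).1.
Proof.
move=> cf lf f_ge0 [z0 fz0].
have epi_graph z : f z \is a fin_num -> epi f (z, fine (f z)).
  by move=> fz; rewrite /epi /= fineK.
have e0 : epi f !=set0 by exists (z0, fine (f z0)); exact: epi_graph.
have ce := closed_epi lf.
have [] := eproj_min (x, 0) ce e0.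
have obtuse d := @eproj_obtuse _ (epi f) (x, 0) d ce
  (fun u v t eu ev => convex_epi cf eu ev).
move: (eproj _ _) obtuse => [y r] /= obtuse yr emin.
have fy : f y \is a fin_num.
  by rewrite ge0_fin_numE //; apply: le_lt_trans yr (ltry _).
have fy0 : 0 <= fine (f y) by exact: fine_ge0.
have fyr : fine (f y) <= r by rewrite -lee_fin fineK.
have /emin := epi_graph _ fy; rewrite /sqdist /= !sub0r !sqrrN lerD2l => r_min.
rewrite /epi_step (_ : fine (f y) = r); last first.
  by apply/eqP; rewrite eq_le fyr -ler_sqr ?nnegrE //=; lra.
split=> // z /epi_graph /obtuse /=; lra.
Qed.

(** * One step of the iteration *)

Lemma econvex_star (R : realType) (f : R -> \bar R) (t x : R) :
  econvex_fun f -> f 0 = 0%E -> (forall z, (0 <= f z)%E) ->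
  0 < t < 1 -> f x \is a fin_num ->
  f (t * x) \is a fin_num /\ fine (f (t * x)) <= t * fine (f x).
Proof.
move=> cf f0 f_ge0 /andP[t0 t1] fx.
have := cf 0 x t t0 t1; rewrite f0 mulr0 mule0 add0r add0e => ftx.
have ftx_fin : f (t * x) \is a fin_num.
  rewrite ge0_fin_numE //; apply: le_lt_trans ftx _.
  by rewrite -(fineK fx) -EFinM ltry.
by split=> //; rewrite -lee_fin EFinM !fineK.
Qed.

Lemma econvex_le_between (R : realType) (f : R -> \bar R) (y x : R) :
  econvex_fun f -> f 0 = 0%E -> (forall z, (0 <= f z)%E) ->
  0 < y < x -> f x \is a fin_num ->
  f y \is a fin_num /\ fine (f y) <= fine (f x).
Proof.
move=> cf f0 f_ge0 /andP[y0 yx] fx; have x0 := lt_trans y0 yx.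
have t01 : 0 < y / x < 1 by rewrite divr_gt0 //= ltr_pdivrMr // mul1r.
have [] := econvex_star cf f0 f_ge0 t01 fx; rewrite divfK ?gt_eqF // => fy fyx.
split=> //; apply: le_trans fyx _; rewrite ler_piMl ?fine_ge0 //.
by case/andP: t01 => _ /ltW.
Qed.

(** The case z = 0 of the optimality condition. *)
Lemma epi_step_sqr (R : realType) (f : R -> \bar R) (x y : R) :
  f 0 = 0%E -> epi_step f x y -> y * (y - x) + fine (f y) ^+ 2 <= 0.
Proof.
by move=> f0 [_ /(_ 0)]; rewrite f0 => /(_ isT) /=; nra.
Qed.

(** Taking z = x in the optimality condition rules out y = 0, where it would
    read x^2 <= 0. *)
Lemma epi_step_decr (R : realType) (f : R -> \bar R) (x y : R) :
  f 0 = 0%E -> (forall z, z != 0 -> (0 < f z)%E) ->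
  0 < x -> f x \is a fin_num -> epi_step f x y ->
  [/\ 0 < y, y < x & 0 < fine (f y)].
Proof.
move=> f0 f_gt0 x0 fx xy.
have [fy var] := xy.
have y_neq0 : y != 0.
  apply/eqP => y0; have := var _ fx; rewrite y0 f0 /= mul0r !subr0.
  by apply/negP; rewrite -ltNge mulr_gt0.
have Fy : 0 < fine (f y).
  by rewrite -lte_fin fineK // f_gt0.
have sq := epi_step_sqr f0 xy.
have yx : 0 < y * (x - y) by nra.
have y0 : 0 < y.
  case: (ltgtP y 0) => // [y_lt0|y0]; last by rewrite y0 eqxx in y_neq0.
  move: yx; rewrite nmulr_rgt0 // subr_lt0 => /lt_trans/(_ y_lt0).
  by rewrite ltNge (ltW x0).
by split=> //; rewrite -subr_gt0 -(pmulr_rgt0 _ y0).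
Qed.

Lemma epi_step_subgradient (R : realType) (f : R -> \bar R) (x y : R) :
  (forall z, (0 <= f z)%E) -> 0 < fine (f y) -> epi_step f x y ->
  subdifferential f y ((x - y) / fine (f y)).
Proof.
move=> f_ge0 Fy [fy var] z; have [fz|] := boolP (f z \is a fin_num); last first.
  by rewrite ge0_fin_numE // -leNgt leye_eq => /eqP ->; rewrite leey.
rewrite -(fineK fy) -(fineK fz) -EFinD lee_fin /= mulrAC -lerBrDl.
by rewrite ler_pdivrMr // [leRHS]mulrC; exact: var.
Qed.

(** The case z = 2 y of the optimality condition: comparing with the point
    twice as far from 0 bounds the slope of f at y by f(2 y) / y. *)
Lemma epi_step_ratio (R : realType) (f : R -> \bar R) (x y : R) :
  0 < y -> f (2 * y) \is a fin_num -> epi_step f x y ->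
  x / y <= 1 + 2 * (fine (f y) / y) * (fine (f (2 * y)) / (2 * y)).
Proof.
move=> y0 f2y [fy /(_ _ f2y) var].
rewrite -subr_ge0.
rewrite (_ : _ - _ = (fine (f y) * fine (f (2 * y)) - (x - y) * y) / y ^+ 2).
  by apply: divr_ge0; [nra|rewrite sqr_ge0].
by field; rewrite gt_eqF.
Qed.

(** * Convergence *)

Lemma cvg_slope_at_right (R : realType) (f : R -> \bar R) :
  f 0 = 0%E -> is_ederive f 0 0 -> fine (f y) / y @[y --> (0 : R)^'+] --> (0 : R).
Proof.
move=> f0 [_ [/cvg_ex [l dl] df]].
have {df} l0 : l = 0 by rewrite -df; apply/esym/cvg_lim.
rewrite l0 in dl; have {dl} := cvg_dnbhs_at_right dl; apply: cvg_trans.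
apply: near_eq_cvg; apply: nearW => h /=.
by rewrite /GRing.scale /= mulr1 addr0 f0 subr0 mulrC.
Qed.

Lemma epi_iter_decr (R : realType) (f : R -> \bar R) (x : R^nat) :
  f 0 = 0%E -> (forall z, z != 0 -> (0 < f z)%E) ->
  0 < x 0%N -> f (x 0%N) \is a fin_num ->
  (forall n, epi_step f (x n) (x n.+1)) ->
  (forall n, 0 < x n) /\ (forall n, x n.+1 < x n).
Proof.
move=> f0 f_gt0 x0 fx0 xS.
have fx n : f (x n) \is a fin_num by case: n => [//|n]; have [] := xS n.
have x_gt0 n : 0 < x n.
  by elim: n => [//|n xn]; have [] := epi_step_decr f0 f_gt0 xn (fx n) (xS n).
split=> // n.
by have [] := epi_step_decr f0 f_gt0 (x_gt0 n) (fx n) (xS n).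
Qed.

(** At a positive limit L, the inequality x_(n+1) (x_(n+1) - x_n) + f(L)^2 <= 0
    would persist while its first term tends to 0. *)
Lemma epi_iter_cvg0 (R : realType) (f : R -> \bar R) (x : R^nat) :
  econvex_fun f -> f 0 = 0%E -> (forall z, z != 0 -> (0 < f z)%E) ->
  0 < x 0%N -> f (x 0%N) \is a fin_num ->
  (forall n, epi_step f (x n) (x n.+1)) ->
  x n @[n --> \oo] --> (0 : R).
Proof.
move=> cf f0 f_gt0 x0 fx0 xS.
have [x_gt0 xdecr] := epi_iter_decr f0 f_gt0 x0 fx0 xS.
have f_ge0 z : (0 <= f z)%E.
  by have [->|/f_gt0/ltW//] := eqVneq z 0; rewrite f0.
have mono : {homo x : n m / (n <= m)%N >-> m <= n}.
  by apply/nonincreasing_seqP => n; exact/ltW/xdecr.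
have cx : cvgn x.
  by apply: nonincreasing_is_cvgn => //; exists 0 => _ [n _ <-]; exact/ltW.
suff L0 : limn x = 0 by rewrite -[X in _ --> X]L0.
have L_ge0 : 0 <= limn x by apply: limr_ge => //; apply: nearW => n; exact/ltW.
have xL n : limn x < x n.
  by apply: le_lt_trans (xdecr n); exact: nonincreasing_cvgn_ge.
apply/eqP; rewrite eq_le L_ge0 andbT leNgt; apply/negP => L_gt0.
have fL n : f (limn x) \is a fin_num /\ fine (f (limn x)) <= fine (f (x n.+1)).
  by apply: econvex_le_between => //; [rewrite L_gt0 xL|have [] := xS n].
have fL_gt0 : 0 < fine (f (limn x)).
  by rewrite -lte_fin fineK ?(fL 0%N).1// f_gt0 // gt_eqF.
have lim0 : x n.+1 * (x n - x n.+1) @[n --> \oo] --> limn x * (limn x - limn x).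
  have cxS : x n.+1 @[n --> \oo] --> limn x by rewrite cvg_shiftS.
  by apply: cvgM => //; exact: cvgB.
have : fine (f (limn x)) ^+ 2 <= limn x * (limn x - limn x).
  apply: (cvgr_to_ge lim0); apply: nearW => n.
  have := epi_step_sqr f0 (xS n); have [_] := fL n; nra.
by rewrite subrr mulr0 leNgt exprn_gt0.
Qed.

(** The inverse ratio x_n / x_(n+1) is squeezed between 1 and a quantity built
    from two difference quotients of f at 0, taken along x_(n+1) and
    2 x_(n+1). *)
Lemma epi_iter_ratio (R : realType) (f : R -> \bar R) (x : R^nat) :
  f 0 = 0%E -> is_ederive f 0 0 ->
  (forall n, epi_step f (x n) (x n.+1)) ->
  (forall n, 0 < x n) -> (forall n, x n.+1 < x n) ->
  x n @[n --> \oo] --> (0 : R) ->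
  x n.+1 / x n @[n --> \oo] --> (1 : R).
Proof.
move=> f0 df xS x_gt0 xdecr x_cvg.
have xS_cvg : x n.+1 @[n --> \oo] --> (0 : R) by rewrite cvg_shiftS.
have x2_cvg : 2 * x n.+1 @[n --> \oo] --> (0 : R).
  by rewrite -(mulr0 2); apply: cvgM => //; exact: cvg_cst.
have /cvg_at_rightP slope := cvg_slope_at_right f0 df.
have s1 : fine (f (x n.+1)) / x n.+1 @[n --> \oo] --> (0 : R) by exact: slope.
have s2 : fine (f (2 * x n.+1)) / (2 * x n.+1) @[n --> \oo] --> (0 : R).
  by apply: (slope (fun n => 2 * x n.+1)); split=> // n; rewrite mulr_gt0.
have f2x : \forall n \near \oo, f (2 * x n.+1) \is a fin_num.
  by have [/x2_cvg] := df.
suff : x n / x n.+1 @[n --> \oo] --> (1 : R).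
  move=> /(cvgV (oner_neq0 R)); rewrite invr1.
  by apply: cvg_trans; apply: near_eq_cvg; apply: nearW => n; rewrite /= invf_div.
apply: (@squeeze_cvgr _ _ _ _ (cst 1) _ _ _ 1); last first.
- rewrite -[X in _ --> X](addr0 1) -[X in 1 + X](mulr0 (2 * 0)).
  apply: cvgD; first exact: cvg_cst.
  by apply: cvgM s2; apply: cvgM s1; exact: cvg_cst.
- exact: cvg_cst.
near=> n; apply/andP; split; first by rewrite /= ler_pdivlMr // mul1r ltW.
by apply: epi_step_ratio => //; near: n.
Unshelve. all: by end_near. Qed.

(** * Ratio of consecutive gaps *)

(** The optimality condition says that z |-> f(y) f(z) - (x - y) z is minimal
    at z = y; Fermat's rule gives the equation. *)
Lemma epi_step_derive (R : realType) (f : R -> \bar R) (x y d : R) :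
  (forall z, 0 <= z <= d -> exists l, is_ederive f z l) -> 0 < y < d ->
  epi_step f x y -> x - y = fine (f y) * derive1 (fine \o f : R -> R) y.
Proof.
move=> df yd [fy var].
have drv (z : R) : z \in `]0, d[%R -> f z \is a fin_num /\ derivable (fine \o f : R -> R) z 1.
  rewrite in_itv /= => /andP[z0 zd]; have [|l [fz [dz _]]] := df z.
    by rewrite !ltW.
  by split=> //; exact: nbhs_singleton fz.
have yI : y \in `]0, d[%R by rewrite in_itv.
pose g := fine (f y) *: (fine \o f : R -> R) - (x - y) *: (@id R).
have gd z : z \in `]0, d[%R -> derivable g z 1.
  by move=> /drv[_ dz]; apply: derivableB; exact: derivableZ.
have d0 : 0 <= d by case/andP: yd => ? ?; rewrite ltW // (lt_trans _ (_ : y < d)).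
have [|_] := derive1_at_min d0 gd yI.
  move=> z /drv[fz _]; rewrite /g /= !fctE; have := var z fz.
  by rewrite /GRing.scale /=; lra.
have [_ dy] := drv _ yI.
rewrite deriveB ?deriveZ //=; last exact: derivableZ.
rewrite derive_id derive1E => /eqP; rewrite subr_eq0 => /eqP.
by rewrite /GRing.scale /= mulr1.
Qed.

Lemma cvg_powR1 (R : realType) (u : R^nat) (q : R) :
  (forall n, 0 < u n) -> u n @[n --> \oo] --> (1 : R) ->
  u n `^ q @[n --> \oo] --> (1 : R).
Proof.
move=> u0 u1; rewrite -[X in _ --> X]expR0 -[X in expR X](mulr0 q) -(@ln1 R).
rewrite (_ : (fun n => _) = (fun n => expR (q * ln (u n)))); last first.
  by apply/funext => n; rewrite /powR gt_eqF.
apply: continuous_cvg; first exact: continuous_expR.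
apply: cvgM; first exact: cvg_cst.
by apply: continuous_cvg => //; exact: continuous_ln.
Qed.

(** Near 0 the gap x_n - x_(n+1) equals phi(x_(n+1)) x_(n+1)^q, with phi
    tending to c.  In the quotient of two consecutive gaps c cancels, and the
    power of x_(n+2) / x_(n+1) tends to 1 whatever the sign of q. *)
Lemma epi_iter_log (R : realType) (f : R -> \bar R) (x : R^nat) (d q c : R) :
  (forall n, epi_step f (x n) (x n.+1)) ->
  (forall n, 0 < x n) -> (forall n, x n.+1 < x n) ->
  x n @[n --> \oo] --> (0 : R) -> x n.+1 / x n @[n --> \oo] --> (1 : R) ->
  0 < d -> (forall y, 0 <= y <= d -> exists l, is_ederive f y l) ->
  0 < c ->
  fine (f y) * derive1 (fine \o f : R -> R) y / y `^ q
    @[y --> (0 : R)^'+] --> c ->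
  (x n.+1 - x n.+2) / (x n - x n.+1) @[n --> \oo] --> (1 : R).
Proof.
move=> xS x_gt0 xdecr x_cvg ratio d0 df c0.
set phi := (X in cvg_to (nbhs (fmap X _))) => /cvg_at_rightP phi_cvg.
have shift (u : R^nat) (l : R) :
    u n @[n --> \oo] --> l -> u n.+1 @[n --> \oo] --> l.
  by rewrite cvg_shiftS.
have phi1 : phi (x n.+1) @[n --> \oo] --> c.
  by apply: phi_cvg; split=> //; exact: shift.
have phi2 := shift (fun n => phi (x n.+1)) _ phi1.
have ratio1 := shift (fun n => x n.+1 / x n) _ ratio.
have ratio_pow : (x n.+2 / x n.+1) `^ q @[n --> \oo] --> (1 : R).
  by apply: cvg_powR1 => // n; exact: divr_gt0.
have gap : \forall n \near \oo, x n - x n.+1 = phi (x n.+1) * x n.+1 `^ q.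
  near=> n; rewrite /phi divfK ?gt_eqF ?powR_gt0 //.
  apply: (epi_step_derive df) => //; rewrite x_gt0 /=.
  by near: n; exact: (cvgr_lt 0 (shift _ _ x_cvg)).
have gap1 : \forall n \near \oo, x n.+1 - x n.+2 = phi (x n.+2) * x n.+2 `^ q.
  by case: gap => N _ NP; exists N => // n /= Nn; apply: NP; exact: leqW.
have c_neq0 : c != 0 by rewrite gt_eqF.
have : phi (x n.+2) * (phi (x n.+1))^-1 * (x n.+2 / x n.+1) `^ q
    @[n --> \oo] --> c * c^-1 * 1.
  by apply: cvgM ratio_pow; apply: cvgM phi2 _; exact: cvgV.
rewrite mulr1 divff //; apply: cvg_trans; apply: near_eq_cvg.
near=> n.
have -> : x n.+1 - x n.+2 = phi (x n.+2) * x n.+2 `^ q by near: n.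
have -> : x n - x n.+1 = phi (x n.+1) * x n.+1 `^ q by near: n.
have -> : x n.+2 `^ q = (x n.+2 / x n.+1) `^ q * x n.+1 `^ q.
  by rewrite -powRM ?divfK ?gt_eqF ?divr_ge0 // ltW.
by rewrite mulrA -[RHS]mulf_div divff ?mulr1 ?gt_eqF ?powR_gt0 // mulrAC.
Unshelve. all: by end_near. Qed.

(** * The alternating projections *)

Theorem theorem4p3 (R : realType) (f : R -> \bar R)
    (f_convex : econvex_fun f)
    (f_lsc : lower_semicontinuous f)
    (f_proper : proper_fun f)
    (f_even : forall x : R, f (- x) = f x)
    (f0 : f 0 = 0%E)
    (f_gt0 : forall x : R, x != 0 -> (0 < f x)%E)
    (f'0 : is_ederive f 0 0)
    (x : R^nat) (a : nat -> R * R)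
    (x0_gt0 : 0 < x 0%N)
    (x0_dom : edom f (x 0%N))
    (a_x : forall n, a n = (x n, 0))
    (a_rec : forall n, a n.+1 = eproj (x_axis R) (eproj (epi f) (a n))) :
  [/\ (forall n,
         ((x n.+1 * (x n.+1 - x n))%:E + f (x n.+1) ^+ 2 <= 0)%E),
      (forall n, exists2 u : R, subdifferential f (x n.+1) u
         & ((x n)%:E = (x n.+1)%:E + f (x n.+1) * u%:E)%E),
      sublinearly_to0 x
    & (forall delta q c : R,
         0 < delta ->
         (forall y : R, 0 <= y <= delta -> exists l : R, is_ederive f y l) ->
         0 < c ->
         fine (f y) * derive1 (fine \o f : R -> R) y / y `^ q
           @[y --> (0 : R)^'+] --> c ->
         logarithmically_to0 x /\
         (x n.+1 - x n.+2) / (x n - x n.+1) @[n --> \oo] --> (1 : R))].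
Proof.
have f_ge0 z : (0 <= f z)%E.
  by have [->|/f_gt0/ltW//] := eqVneq z 0; rewrite f0.
have fx0 : f (x 0%N) \is a fin_num by rewrite ge0_fin_numE.
have xS n : epi_step f (x n) (x n.+1).
  suff -> : x n.+1 = (eproj (epi f) (x n, 0)).1.
    by apply: eproj_epi_step => //; exists (x 0%N).
  by have := a_rec n; rewrite !a_x eproj_x_axis => -[].
have fx n : f (x n) \is a fin_num by case: n => [//|n]; have [] := xS n.
have [x_gt0 xdecr] := epi_iter_decr f0 f_gt0 x0_gt0 fx0 xS.
have x_cvg := epi_iter_cvg0 f_convex f0 f_gt0 x0_gt0 fx0 xS.
have ratio := epi_iter_ratio f0 f'0 xS x_gt0 xdecr x_cvg.
split.
- move=> n; rewrite -(fineK (fx n.+1)) -EFin_expe -EFinD lee_fin.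
  exact: epi_step_sqr.
- move=> n.
  have [_ _ Fx] := epi_step_decr f0 f_gt0 (x_gt0 n) (fx n) (xS n).
  exists ((x n - x n.+1) / fine (f (x n.+1))).
    exact: epi_step_subgradient.
  rewrite -[f _]fineK // -EFinM -EFinD mulrC divfK ?gt_eqF //.
  by congr EFin; ring.
- by split.
- move=> delta q c d0 df c0 phi.
  have gap_ratio := epi_iter_log xS x_gt0 xdecr x_cvg ratio d0 df c0 phi.
  split=> //; split; first by split.
  apply: cvg_trans gap_ratio; apply: near_eq_cvg; apply: nearW => n.
  by rewrite !gtr0_norm ?subr_gt0.
Qed.
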